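(* Let $F$ be a field and let $A$ be a (finitely generated) monomial algebra over $F$. Then: (i) $A$ is of the form $A_w$ for some right-infinite word $w$ over its finite set of monomial generators if and only if $A$ admits a faithful (right) point module; and (ii) $A$ is (right) prolongable if and only if the intersection of the annihilators $\mathrm{Ann}_A(P)$, taken over all (right) point $A$-modules $P$, is zero.
   Context: A monomial algebra is a quotient $A=F\langle x_1,\dots,x_m\rangle/I$ of a free associative algebra by a (proper) two-sided ideal $I$ generated by monomials; it is graded by $\deg x_i=1$. For a right-infinite word $w\in\{x_1,\dots,x_m\}^{\mathbb N}$, $A_w=F\langle x_1,\dots,x_m\rangle/\langle u : u \text{ is a monomial which is not a finite factor (contiguous subword) of } w\rangle$. A right point module over a connected graded algebra $A=\bigoplus_{n\ge 0}A_n$ generated in degree $1$ is a graded cyclic right $A$-module $P=\bigoplus_{n\ge0}P_n$ generated in degree $0$ with $\dim_F P_n=1$ for all $n\ge 0$. A monomial algebra $A$ is (right) prolongable if for every non-zero monomial $u\in A$ there is a non-empty monomial $v$ with $uv\ne 0$ in $A$. Modules are right modules. An empty intersection of annihilators is taken to be $A$. *)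

(* Defs.v *)
From HB Require Import structures.
From mathcomp Require Import all_boot all_algebra.
From mathcomp Require Import boolp classical_sets.
From mathcomp Require Import finmap monalg.

Set Implicit Arguments.
Unset Strict Implicit.
Unset Printing Implicit Defensive.

Import GRing.Theory.
Local Open Scope ring_scope.
Local Open Scope quotient_scope.
Local Open Scope classical_set_scope.

(* The free associative algebra F<x_1, ..., x_m>: the monoid algebra of the
   free monoid on 'I_m, where x_i is the variable of index i. *)
Notation freeAlg F m := {malg F[{fmonom 'I_m}]}.

Lemma malg_scaleAr (K : monomType) (R : comNzRingType) (k : R)
    (f g : {malg R[K]}) : k *: (f * g) = f * (k *: g).
Proof.
rewrite [f * g]malgME [f * (k *: g)](malgMEw (fsubset_refl _) (msuppZ_le _ _)).
rewrite scaler_sumr; apply: eq_bigr => u _.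
rewrite scaler_sumr; apply: eq_bigr => v _.
apply/malgP => w.
transitivity (k * ((f@_u * g@_v) *+ (mmul u v == w))).
  by rewrite mcoeffZ; congr (_ * _); apply: mcoeffU.
by rewrite (mcoeffU _ _ w) (mcoeffZ _ g) mulrCA mulrnAr.
Qed.

Definition two_sided_ideal (R : pzRingType) (J : set R) : Prop :=
  [/\ J 0,
      forall x y, J x -> J y -> J (x + y),
      forall a x, J x -> J (a * x) &
      forall a x, J x -> J (x * a)].

(* [smallest two_sided_ideal X] is the two-sided ideal generated by X. *)
Definition ideal_of_words (F : fieldType) (m : nat) (G : set {fmonom 'I_m}) :
    set (freeAlg F m) :=
  smallest (@two_sided_ideal (freeAlg F m)) [set << u >> | u in G].

(* Equality of monomial algebras, as quotients of the same free algebra, is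
   equality of these ideals (the last two fields are proof-irrelevant). *)
Record monomialIdeal (F : fieldType) (m : nat) := MonomialIdeal {
  mideal :> set (freeAlg F m);
  mideal_words : exists G : set {fmonom 'I_m}, mideal = @ideal_of_words F m G;
  mideal_proper : ~ mideal 1
}.

Lemma ideal_of_words_ideal (F : fieldType) (m : nat) (G : set {fmonom 'I_m}) :
  two_sided_ideal (@ideal_of_words F m G).
Proof.
split=> [J [[]]//|x y xG yG J JG|a x xG J JG|a x xG J JG];
  have [[J0 JD JM JM'] GJ] := JG.
- by apply: JD; [apply: xG|apply: yG].
- by apply: JM; apply: xG.
- by apply: JM'; apply: xG.
Qed.

Section MonomialAlgebra.
Context (F : fieldType) (m : nat) (I : monomialIdeal F m).

Lemma mideal_ideal : two_sided_ideal (mideal I).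
Proof. by have [G ->] := mideal_words I; apply: ideal_of_words_ideal. Qed.

(* The library's quotient takes a boolean predicate. *)
Definition mideal_pred : {pred freeAlg F m} := fun f => `[< mideal I f >].

Lemma mideal_zmod_closed : zmod_closed mideal_pred.
Proof.
have [I0 ID IM _] := mideal_ideal; split; first exact/asboolP.
move=> x y /asboolP xI /asboolP yI; apply/asboolP.
by apply: ID => //; rewrite -mulN1r; apply: IM.
Qed.

HB.instance Definition _ := GRing.isZmodClosed.Build _ mideal_pred
  mideal_zmod_closed.

Definition mideal_zmod : zmodClosed (freeAlg F m) := mideal_pred.

Definition monomialAlgebra : Type := {ideal_quot mideal_zmod}.

HB.instance Definition _ := GRing.Zmodule.on monomialAlgebra.

Local Notation A := monomialAlgebra.

Definition mproj : freeAlg F m -> A := \pi_{ideal_quot mideal_zmod}.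

Lemma mproj_eq (f g : freeAlg F m) : mproj f = mproj g <-> mideal I (f - g).
Proof.
by split=> [/eqP|h]; [|apply/eqP];
  rewrite /mproj piE Quotient.equivE => *; apply/asboolP.
Qed.

Lemma mprojB : zmod_morphism mproj.
Proof. by move=> f g; rewrite /mproj raddfB. Qed.

HB.instance Definition _ := GRing.isZmodMorphism.Build _ A mproj mprojB.

Lemma mproj_repr (a : A) : mproj (repr a) = a.
Proof. exact: reprK. Qed.

Definition qone : A := mproj 1.
Definition qmul (a b : A) : A := mproj (repr a * repr b).
Definition qscale (k : F) (a : A) : A := mproj (k *: repr a).

Lemma mprojM_subproof (f g : freeAlg F m) : mproj (f * g) = qmul (mproj f) (mproj g).
Proof.
have [I0 ID IM IM'] := mideal_ideal; apply/mproj_eq.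
set f' := repr _; set g' := repr _.
have If : mideal I (f - f') by apply/mproj_eq; rewrite mproj_repr.
have Ig : mideal I (g - g') by apply/mproj_eq; rewrite mproj_repr.
have -> : f * g - f' * g' = (f - f') * g + f' * (g - g').
  by rewrite mulrBl mulrBr addrA subrK.
by apply: ID; [apply: IM'|apply: IM].
Qed.

Lemma mprojZ_subproof k (f : freeAlg F m) : mproj (k *: f) = qscale k (mproj f).
Proof.
have [I0 ID IM IM'] := mideal_ideal; apply/mproj_eq.
have If : mideal I (f - repr (mproj f)) by apply/mproj_eq; rewrite mproj_repr.
by rewrite -scalerBr -mul_malgC; apply: IM.
Qed.

Lemma qmulA : associative qmul.
Proof.
move=> a b c; rewrite -[a]mproj_repr -[b]mproj_repr -[c]mproj_repr.
by rewrite -!mprojM_subproof mulrA.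
Qed.

Lemma qmul1 : left_id qone qmul.
Proof. by move=> a; rewrite -[a]mproj_repr -mprojM_subproof mul1r. Qed.

Lemma qmulr1 : right_id qone qmul.
Proof. by move=> a; rewrite -[a]mproj_repr -mprojM_subproof mulr1. Qed.

Lemma qmulDl : left_distributive qmul +%R.
Proof.
move=> a b c; rewrite -[a]mproj_repr -[b]mproj_repr -[c]mproj_repr.
by rewrite -raddfD -!mprojM_subproof mulrDl raddfD.
Qed.

Lemma qmulDr : right_distributive qmul +%R.
Proof.
move=> a b c; rewrite -[a]mproj_repr -[b]mproj_repr -[c]mproj_repr.
by rewrite -raddfD -!mprojM_subproof mulrDr raddfD.
Qed.

Lemma qone_neq0 : qone != 0.
Proof.
apply/eqP; rewrite -(raddf0 mproj) => /mproj_eq; rewrite subr0.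
exact: mideal_proper.
Qed.

HB.instance Definition _ := GRing.Zmodule_isNzRing.Build A
  qmulA qmul1 qmulr1 qmulDl qmulDr qone_neq0.

Lemma mproj_monoid_morphism : monoid_morphism mproj.
Proof. by split=> // f g; apply: mprojM_subproof. Qed.

HB.instance Definition _ :=
  GRing.isMonoidMorphism.Build _ A mproj mproj_monoid_morphism.

Lemma qscaleA k l (a : A) : qscale k (qscale l a) = qscale (k * l) a.
Proof. by rewrite -[a]mproj_repr -!mprojZ_subproof scalerA. Qed.

Lemma qscale1 : left_id 1 qscale.
Proof. by move=> a; rewrite -[a]mproj_repr -mprojZ_subproof scale1r. Qed.

Lemma qscaleDr : right_distributive qscale +%R.
Proof.
move=> k a b; rewrite -[a]mproj_repr -[b]mproj_repr.
by rewrite -raddfD -!mprojZ_subproof scalerDr raddfD.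
Qed.

Lemma qscaleDl (a : A) : {morph qscale^~ a : k l / k + l}.
Proof.
by move=> k l; rewrite -[a]mproj_repr -!mprojZ_subproof scalerDl raddfD.
Qed.

HB.instance Definition _ := GRing.Zmodule_isLmodule.Build F A
  qscaleA qscale1 qscaleDr qscaleDl.

Lemma mproj_scalable : scalable mproj.
Proof. by move=> k f; apply: mprojZ_subproof. Qed.

HB.instance Definition _ :=
  GRing.isScalable.Build F (freeAlg F m) A *:%R mproj mproj_scalable.

Lemma qscaleAl (k : F) (a b : A) : k *: (a * b) = (k *: a) * b.
Proof.
rewrite -[a]mproj_repr -[b]mproj_repr.
by rewrite -rmorphM -!linearZ -rmorphM scalerAl.
Qed.

HB.instance Definition _ := GRing.Lmodule_isLalgebra.Build F A qscaleAl.

Lemma qscaleAr (k : F) (a b : A) : k *: (a * b) = a * (k *: b).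
Proof.
rewrite -[a]mproj_repr -[b]mproj_repr.
by rewrite -rmorphM -!linearZ -rmorphM; congr mproj; apply: malg_scaleAr.
Qed.

HB.instance Definition _ := GRing.Lalgebra_isAlgebra.Build F A qscaleAr.

Definition mmonom (u : {fmonom 'I_m}) : A := mproj << u >>.

(* The grading of A with deg x_i = 1. *)
Definition mcomponent (n : nat) : set A :=
  [set mproj f | f in [set f : freeAlg F m |
                        forall u, u \in msupp f -> fdeg u = n]].

Definition prolongable : Prop :=
  forall u : {fmonom 'I_m}, mmonom u <> 0 ->
    exists v : {fmonom 'I_m}, fmonom_val v <> [::] /\ mmonom u * mmonom v <> 0.

End MonomialAlgebra.

Arguments mproj {F m} I _.
Arguments mmonom {F m} I u.
Arguments mcomponent {F m} I n.
Arguments prolongable {F m} I.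

(* u = w_i w_{i+1} ... w_{i+|u|-1} for some i *)
Definition factor (m : nat) (w : nat -> 'I_m) (u : {fmonom 'I_m}) : Prop :=
  exists i : nat, fmonom_val u = [seq w (i + k)%N | k <- iota 0 (fdeg u)].

Section WordAlgebra.
Context (F : fieldType) (m : nat) (w : nat -> 'I_m).

Lemma word_ideal_proper : ~ ideal_of_words (F := F) [set u | ~ factor w u] 1.
Proof.
move=> /(_ [set f : freeAlg F m | f@_mone = 0]) h.
have /eqP : (1 : freeAlg F m)@_(mone) = 0; last by rewrite mcoeff1 eqxx oner_eq0.
apply: h; split=> [|_ [u uw <-]] /=; last first.
  rewrite mcoeffU1; case: eqP => // u1; case: uw; exists 0%N.
  by rewrite u1 fdeg1 fm1.
split=> /= [|f g f0 g0|g f f0|g f f0]; first exact: mcoeff0.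
- by rewrite mcoeffD f0 g0 addr0.
- by rewrite rmorphM /= f0 mulr0.
- by rewrite rmorphM /= f0 mul0r.
Qed.

(* A_w is [monomialAlgebra word_ideal]. *)
Definition word_ideal : monomialIdeal F m :=
  MonomialIdeal (ex_intro _ _ erefl) word_ideal_proper.

End WordAlgebra.

(* A right A-module is a left module over the converse ring A^c; F acts on it
   through the scalars k%:A of A. *)
Section RightModule.
Context (F : fieldType) (m : nat) (I : monomialIdeal F m).
Local Notation A := (monomialAlgebra I).

Definition ract (P : lmodType A^c) (v : P) (a : A) : P := (a : A^c) *: v.

Definition annihilator (P : lmodType A^c) : set A :=
  [set a | forall v : P, ract v a = 0].

Definition subspace (P : lmodType A^c) (V : set P) : Prop :=
  [/\ V 0,
      forall v v', V v -> V v' -> V (v + v') &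
      forall (k : F) v, V v -> V (ract v k%:A)].

(* P is the (internal) direct sum of the family gr. *)
Definition direct_sum (P : lmodType A^c) (gr : nat -> set P) : Prop :=
  (forall v : P, exists (N : nat) (p : nat -> P),
      (forall n, gr n (p n)) /\ v = \sum_(n < N) p n) /\
  (forall (N : nat) (p : nat -> P), (forall n, gr n (p n)) ->
      \sum_(n < N) p n = 0 -> forall n, (n < N)%N -> p n = 0).

Definition dim1 (P : lmodType A^c) (V : set P) : Prop :=
  exists v : P, [/\ V v, v <> 0 & forall v', V v' -> exists k : F, v' = ract v k%:A].

(* The generator is taken in degree 0, so pm_cyclic says P = v0 A. *)
Record pointModule := PointModule {
  pm_module :> lmodType A^c;
  pm_gr : nat -> set pm_module;
  pm_subspace : forall n, subspace (pm_gr n);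
  pm_direct : direct_sum pm_gr;
  pm_graded : forall n k v a,
    pm_gr n v -> mcomponent I k a -> pm_gr (n + k)%N (ract v a);
  pm_cyclic : exists v0, pm_gr 0%N v0 /\ forall v, exists a, v = ract v0 a;
  pm_dim1 : forall n, dim1 (pm_gr n)
}.

Definition faithful (P : lmodType A^c) : Prop := annihilator P = [set 0].

(* The whole of A when there is no point module. *)
Definition point_annihilator : set A :=
  [set a | forall P : pointModule, annihilator P a].

End RightModule.

Arguments pointModule {F m} I.
Arguments point_annihilator {F m} I _.

(* Main.v *)
From HB Require Import structures.
Require Import Defs.
From mathcomp Require Import all_boot all_algebra.
From mathcomp Require Import boolp classical_sets.
From mathcomp Require Import finmap monalg zify.

(* An infinite word w whose factors are all nonzero in A gives a point module
   with basis (e_n) on which x_(w n) sends e_n to e_(n+1) and the other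
   variables kill e_n; the coefficient of e_(n+k) in e_n f is the coefficient
   in f of the factor of w of length k at n. Hence this module is faithful over
   A_w, and if A is prolongable these modules separate the elements of A.
   Conversely, a point module with basis (e_n) is described up to scalars by
   the nonempty sets of letters i with e_n x_i <> 0. If it is faithful, two
   words of the same length both acting nontrivially on e_0 only must
   coincide, as a nontrivial combination of them would act as zero. This makes
   all words nonzero in A factors of one infinite word. *)

Set Implicit Arguments.
Unset Strict Implicit.
Unset Printing Implicit Defensive.
Import GRing.Theory.

(** * Infinite words and letters allowed position by position *)

Section Words.
Context (T : Type).
Implicit Types (S : nat -> T -> Prop) (w : nat -> T) (u v : seq T).

Definition segment w i k := map w (iota i k).

Lemma size_segment w i k : size (segment w i k) = k.
Proof. by rewrite size_map size_iota. Qed.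

Lemma segmentD w i k l : segment w i (k + l) = segment w i k ++ segment w (i + k) l.
Proof. by rewrite /segment iotaD map_cat. Qed.

Lemma segment_inj w w' :
  (forall k, exists2 l, k <= l & segment w 0 l = segment w' 0 l) -> w =1 w'.
Proof.
move=> h i; have [l lti e] := h i.+1.
have := congr1 (fun s => nth (w i) s i) e.
by rewrite !(nth_map 0) ?size_iota // !nth_iota.
Qed.

Definition is_factor w u := exists i, u = segment w i (size u).

Lemma infix_factor w p u s : is_factor w (p ++ u ++ s) -> is_factor w u.
Proof.
case=> i; rewrite !size_cat !segmentD => e; exists (i + size p).
move/(congr1 (drop (size p))): e; rewrite drop_size_cat // drop_size_cat ?size_segment //.
by move/(congr1 (take (size u))); rewrite take_size_cat // take_size_cat ?size_segment.
Qed.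

(** [S n] is the set of letters allowed at position [n]; for a point module, those that do not kill
    [e_n]. *)
Fixpoint occurs S n u := if u is x :: u' then S n x /\ occurs S n.+1 u' else True.

Lemma occurs_cat S n u v :
  occurs S n (u ++ v) <-> occurs S n u /\ occurs S (n + size u) v.
Proof.
elim: u n => [|x u IH] n /=; first by rewrite addn0; tauto.
by rewrite IH addSnnS; tauto.
Qed.

Lemma occurs_nth S n u x0 :
  occurs S n u <-> (forall i, i < size u -> S (n + i) (nth x0 u i)).
Proof.
elim: u n => [|x u IH] n /=; first by split.
rewrite IH; split=> [[Sx h] [|i] lti|h]; first by rewrite addn0.
- by rewrite addnS -addSn; apply: h.
- split; first by have := h 0 isT; rewrite addn0.
  by move=> i lti; rewrite addSnnS; apply: (h i.+1).
Qed.

Lemma occurs_segment S w i k : (forall j, S j (w j)) -> occurs S i (segment w i k).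
Proof. by move=> Sw; elim: k i => //= k IH i; split=> //; apply: IH. Qed.

(** The default [w i] of [nth] makes the word follow [w] again once [u] is exhausted. *)
Definition splice w n u i := if n <= i then nth (w i) u (i - n) else w i.

Lemma segment_splice w n u : segment (splice w n u) n (size u) = u.
Proof.
case: u => // x u; apply: (@eq_from_nth _ x); rewrite ?size_segment // => i lti.
rewrite (nth_map 0) ?size_iota // nth_iota // /splice leq_addr addKn.
exact: set_nth_default.
Qed.

Lemma segment_splice_before w n u i k :
  i + k <= n -> segment (splice w n u) i k = segment w i k.
Proof.
move=> le; apply/eq_in_map => j; rewrite mem_iota => lej.
by rewrite /splice ifF //; lia.
Qed.

Lemma splice_occurs S w n u : (forall i, S i (w i)) -> occurs S n u ->
  forall i, S i (splice w n u i).
Proof.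
move=> Sw Su i; rewrite /splice; case: leqP => // le.
have [lt|ge] := ltnP (i - n) (size u); last by rewrite nth_default.
by have := (occurs_nth S n u (w i)).1 Su _ lt; rewrite subnKC.
Qed.

(** Iterating the step gives strictly growing prefixes, whose limit is [w]; the index [j] of [Q]
    lets each stage meet its own demand. *)
Lemma prolongation_limit (P : seq T -> Prop) (Q : nat -> seq T -> Prop) p0 :
    P p0 ->
    (forall j p, P p -> exists q, [/\ q <> [::], P (p ++ q) & Q j (p ++ q)]) ->
  exists w, segment w 0 (size p0) = p0 /\
    forall j, exists l, [/\ j <= l, P (segment w 0 l) & Q j (segment w 0 l)].
Proof.
move=> Pp0 step.
(* The first extension is nonempty and supplies a default letter for [nth]. *)
have x0 : T by case: (cid (step 0 p0 Pp0)) => -[|x q [] //] [].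
have [ext extP] : {ext : nat -> seq T -> seq T | forall j p, P p ->
    [/\ ext j p <> [::], P (p ++ ext j p) & Q j (p ++ ext j p)]}.
  have h j p : exists q, P p -> [/\ q <> [::], P (p ++ q) & Q j (p ++ q)].
    by case: (pselect (P p)) => [/(step j)[q qP]|]; [exists q|exists [::]].
  by exists (fun j p => projT1 (cid (h j p))) => j p; apply: projT2 (cid (h j p)).
pose fix s j := if j is j'.+1 then s j' ++ ext j' (s j') else p0.
have sP j : P (s j) by elim: j => //= j Pj; case: (extP j _ Pj).
have sQ j : Q j (s j.+1) by case: (extP j _ (sP j)).
have ssz j : j <= size (s j).
  elim: j => //= j IH; rewrite size_cat.
  by case: (extP j _ (sP j)); case: (ext j _) => //= *; lia.
have scat j k : exists q, s (j + k) = s j ++ q.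
  elim: k => [|k [q IH]]; first by exists [::]; rewrite addn0 cats0.
  by rewrite addnS /= IH -catA; eexists.
pose w i := nth x0 (s i.+1) i.
have sw j : segment w 0 (size (s j)) = s j.
  apply: (@eq_from_nth _ x0); rewrite ?size_segment // => i lti.
  rewrite (nth_map 0) ?size_iota // nth_iota // add0n /w.
  (* Both [s j] and [s i.+1] are prefixes of [s (j + i.+1)], so their letters at [i] agree. *)
  have [q1 e1] := scat j i.+1; have [q2 e2] := scat i.+1 j.
  have := congr1 (fun v => nth x0 v i) e1.
  rewrite nth_cat lti addnC e2 nth_cat ifT //; exact: ssz.
exists w; split; first exact: (sw 0).
move=> j; exists (size (s j.+1)); rewrite sw; split=> //.
exact: leq_trans (ssz j.+1).
Qed.

End Words.

(* If all words recur, a word containing all of them is built greedily.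
   Otherwise fix a transient word u, last occurring at n. A prefix containing
   u at n occurs only at 0, so w is the only infinite word through u; the same
   holds for any other transient word, and a word v recurring after u may be
   spliced into w. *)
Lemma occurs_factor_word (T : countType) (S : nat -> T -> Prop) :
    (forall n, exists x, S n x) ->
    (forall u v, size u = size v ->
       occurs S 0 u -> occurs S 0 v ->
       (forall n, 0 < n -> ~ occurs S n u) ->
       (forall n, 0 < n -> ~ occurs S n v) -> u = v) ->
  exists w, forall u, (exists n, occurs S n u) <-> is_factor w u.
Proof.
move=> /choice[s Ss] uniq0.
have [recur|/existsNP[u /not_implyP[[n0 un0] /existsNP[b ub]]]] :=
    pselect (forall u, (exists n, occurs S n u) ->
      forall b, exists2 n, b <= n & occurs S n u).
  (* Stage [j] demands that the prefix end with the word of code [j], if that word occurs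
     anywhere. *)
  pose Q j p := forall u, choice.unpickle j = Some u -> (exists n, occurs S n u) ->
    exists q, p = q ++ u.
  have [//|j p Pp|w [_ wP]] := @prolongation_limit T (occurs S 0) Q [::].
    pose u := odflt [::] (choice.unpickle j : option (seq T)).
    have [[n un]|nu] := pselect (exists n, occurs S n u).
      (* The strict bound makes the padding taken from [s] nonempty, even when [u] is empty. *)
      have [N leN uN] := recur u (ex_intro _ n un) (size p).+1.
      exists (segment s (size p) (N - size p) ++ u); split.
      - case e : (N - size p) => [|k] //; lia.
      - rewrite !occurs_cat size_segment add0n subnKC 1?ltnW //.
        by do !split=> //; apply: occurs_segment.
      - by move=> v ev _; rewrite /u ev catA; eexists.
    exists [:: s (size p)]; split=> //; first by rewrite occurs_cat /=.
    by move=> v ev ov; case: nu; rewrite /u ev.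
  have Sw i : S i (w i).
    have [l [lti Pl _]] := wP i.+1.
    have := (occurs_nth S 0 _ (w i)).1 Pl i; rewrite size_segment => /(_ lti).
    by rewrite (nth_map 0) ?size_iota // nth_iota.
  exists w => u; split=> [ou|[i ->]]; last by exists i; apply: occurs_segment.
  have [l [_ _ Ql]] := wP (choice.pickle u); have [q e] := Ql _ (choice.pickleK u) ou.
  by apply: (@infix_factor _ w q u [::]); exists 0; rewrite cats0 -e size_segment.
pose last u n := occurs S n u /\ forall n', n < n' -> ~ occurs S n' u.
have lastP u' b' m : occurs S m u' -> ~ (exists2 n', b' <= n' & occurs S n' u') ->
    exists n', last u' n'.
  move=> um ub'; have ex : exists n', `[< occurs S n' u' >] by exists m; apply/asboolP.
  have bd n' : `[< occurs S n' u' >] -> n' <= b'.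
    move=> /asboolP o; rewrite leqNgt; apply/negP => lt; apply: ub'.
    by exists n' => //; apply: ltnW.
  case: (ex_maxnP ex bd) => n' /asboolP on' mx; exists n'; split=> // k lt ok.
  by have := mx k; rewrite asboolT // => /(_ isT); lia.
have {ub un0 n0 b} [n [un umax]] := lastP _ _ _ un0 ub.
pose thru w u n := (forall i, S i (w i)) /\ segment w n (size u) = u.
have rigid w w' u1 n1 u2 n2 :
    last u1 n1 -> last u2 n2 -> thru w u1 n1 -> thru w' u2 n2 -> w =1 w'.
  move=> l1 l2 t1 t2; apply: segment_inj => k.
  (* A prefix of this length contains both marked occurrences. *)
  pose l := k + (n1 + size u1 + (n2 + size u2)); exists l; first exact: leq_addr.
  have only0 w1 u3 n3 : last u3 n3 -> thru w1 u3 n3 -> n3 + size u3 <= l ->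
      forall c, 0 < c -> ~ occurs S c (segment w1 0 l).
    move=> [_ mx] [_ e] le c c0.
    (* An occurrence of the prefix at [c > 0] would put [u3] at [c + n3], past its last position. *)
    rewrite -(subnKC le) !segmentD add0n e !occurs_cat size_segment => -[[_]].
    by move=> /mx; case; lia.
  apply: uniq0; rewrite ?size_segment //.
  - by apply: occurs_segment; case: t1.
  - by apply: occurs_segment; case: t2.
  - by apply: only0 l1 t1 _; lia.
  - by apply: only0 l2 t2 _; lia.
have thru_splice w u' n' : (forall i, S i (w i)) -> occurs S n' u' ->
    thru (splice w n' u') u' n'.
  by move=> Sw ou'; split; [apply: splice_occurs|apply: segment_splice].
have [Sw wu] := thru_splice s u n Ss un; set w := splice s n u in Sw wu.
exists w => v; split=> [[m vm]|[i ->]]; last by exists i; apply: occurs_segment.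
have [[c lec vc]|/(lastP _ _ _ vm)[c lc]] :=
    pselect (exists2 c, n + size u <= c & occurs S c v).
  have [Sw' wv] := thru_splice w v c Sw vc.
  (* Splicing beyond the marked [u] leaves it intact, so by rigidity the spliced word is [w]. *)
  have /funext -> : w =1 splice w c v.
    apply: rigid (conj un umax) (conj un umax) (conj Sw wu) _.
    by split=> //; rewrite segment_splice_before.
  by exists c.
(* Here [v] is itself transient, so a word through its last occurrence is again [w]. *)
have tv := thru_splice s v c Ss lc.1.
rewrite (funext (rigid _ _ _ _ _ _ (conj un umax) lc (conj Sw wu) tv)).
by exists c; case: tv.
Qed.

Local Open Scope classical_set_scope.
Local Open Scope ring_scope.

(** * Supports, monomial ideals and the path action in the free algebra *)

Section FreeAlgebra.
Context (F : fieldType) (m : nat).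
Implicit Types (f g : freeAlg F m) (u v : {fmonom 'I_m}) (w : nat -> 'I_m).

Lemma word_mul (u v : seq 'I_m) : mmul (FMonom u) (FMonom v) = FMonom (u ++ v).
Proof. exact: fmmulE. Qed.

Lemma mone_word : mone = FMonom [::] :> {fmonom 'I_m}.
Proof. exact: fmoneE. Qed.

Lemma malgU1M u v : << u >> * << v >> = << mmul u v >> :> freeAlg F m.
Proof. by rewrite malgM_def fgmulUU mulr1. Qed.

Lemma malgU_scale (c : F) u : << c *g u >> = c *: << u >> :> freeAlg F m.
Proof. by apply/malgP => v; rewrite mcoeffZ !mcoeffU mulr_natr mulrb. Qed.

Lemma mcoeff_sum_msupp f u : \sum_(v <- msupp f) f@_v *+ (v == u) = f@_u.
Proof.
by rewrite [in RHS](monalgE f) raddf_sum; apply: eq_bigr => v _; rewrite /= mcoeffU.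
Qed.

(** A factorization of [s] into two words is determined by the length of the first. *)
Lemma mcoeffM_splits f g (s : seq 'I_m) :
  (f * g)@_(FMonom s) =
  \sum_(k < (size s).+1) f@_(FMonom (take k s)) * g@_(FMonom (drop k s)).
Proof.
rewrite mcoeffMl.
under [RHS]eq_bigr => k _.
  rewrite -mcoeff_sum_msupp -(mcoeff_sum_msupp g) mulr_suml.
  under eq_bigr do rewrite mulr_sumr; over.
rewrite [RHS]exchange_big; apply: eq_bigr => -[u] _.
rewrite [RHS]exchange_big; apply: eq_bigr => -[v] _.
rewrite word_mul; have [[es]|ne] := eqVneq (FMonom (u ++ v)) (FMonom s).
  have ltu : (size u < (size s).+1)%N by rewrite -es size_cat ltnS leq_addr.
  rewrite (bigD1 (Ordinal ltu)) //= big1 ?addr0 => [|k /eqP nk].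
    by rewrite -es take_size_cat // drop_size_cat // !eqxx.
  case: eqP => [[eu]|]; last by rewrite mulr0n mul0r.
  by case: nk; apply/val_inj; rewrite /= eu size_takel // -ltnS.
rewrite big1 // => k _; case: eqP => [eu|]; last by rewrite mulr0n mul0r.
case: eqP => [ev|]; last by rewrite mulr0n mulr0.
by case: eu ev ne => -> [->]; rewrite cat_take_drop eqxx.
Qed.

Lemma mcoeffM_segment f g w n l :
  (f * g)@_(FMonom (segment w n l)) =
  \sum_(k < l.+1) f@_(FMonom (segment w n k)) * g@_(FMonom (segment w (n + k) (l - k))).
Proof.
rewrite mcoeffM_splits size_segment; apply: eq_bigr => -[k ltk] _ /=.
rewrite -{1 2}(subnKC (ltnSE ltk)).
by rewrite segmentD take_size_cat ?drop_size_cat ?size_segment.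
Qed.

(** The elements whose words all lie in the ideal form an ideal containing the generators. *)
Lemma ideal_of_words_msupp (G : set {fmonom 'I_m}) f :
  ideal_of_words G f <->
  forall u, u \in msupp f -> ideal_of_words G (<< u >> : freeAlg F m).
Proof.
have [I0 ID IM IM'] := @ideal_of_words_ideal F m G; split; last first.
  move=> h; rewrite (monalgE f) big_seq; elim/big_ind: _ => // u uf.
  by rewrite malgU_scale -mul_malgC; apply: IM; apply: h.
move=> If; apply: (If [set g | forall u, u \in msupp g -> ideal_of_words G << u >>]).
split=> [|_ [u Gu <-] v /=]; last first.
  by rewrite msuppU1 inE => /eqP -> J [_]; apply; exists u.
split=> /= [u|x y hx hy u /(fsubsetP (msuppD_le _ _))|a x hx u|a x hx u].
- by rewrite msupp0.
- by rewrite in_fsetU => /orP[/hx|/hy].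
- move=> /msuppM_le[u1 [u2 [_ /hx h ->]]]; rewrite -malgU1M; exact: IM.
- move=> /msuppM_le[u1 [u2 [/hx h _ ->]]]; rewrite -malgU1M; exact: IM'.
Qed.

(** For such [G] the elements supported in [G] already form an ideal. *)
Lemma ideal_of_words_absorbing (G : set {fmonom 'I_m}) u :
    (forall u1 v u2, G v -> G (mmul (mmul u1 v) u2)) ->
  ideal_of_words G (<< u >> : freeAlg F m) <-> G u.
Proof.
move=> absG; split; last by move=> Gu J [_]; apply; exists u.
move=> /(_ [set g | forall u, u \in msupp g -> G u]); apply; last by rewrite msuppU1 inE.
split=> [|_ [v Gv <-] v' /=]; last by rewrite msuppU1 inE => /eqP ->.
split=> /= [v|x y hx hy v /(fsubsetP (msuppD_le _ _))|a x hx v|a x hx v].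
- by rewrite msupp0.
- by rewrite in_fsetU => /orP[/hx|/hy].
- move=> /msuppM_le[u1 [u2 [_ /hx h ->]]].
  by rewrite -[mmul _ _]mulm1; apply: absG.
- move=> /msuppM_le[u1 [u2 [/hx h _ ->]]].
  by rewrite -[u1]mul1m; apply: absG.
Qed.

Lemma factorP w (u : seq 'I_m) : factor w (FMonom u) <-> is_factor w u.
Proof.
have e i : [seq w (i + k)%N | k <- iota 0 (size u)] = segment w i (size u).
  by rewrite /segment -{2}[i]addn0 iotaDl -map_comp.
by split=> -[i ei]; exists i; move: ei; rewrite -e.
Qed.

Lemma word_idealP w (u : seq 'I_m) :
  mideal (word_ideal F w) << FMonom u >> <-> ~ is_factor w u.
Proof.
rewrite /= ideal_of_words_absorbing /=; first by rewrite factorP.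
move=> [u1] [v] [u2]; rewrite !word_mul !factorP -catA => nv /infix_factor.
exact: nv.
Qed.

(* The right action of the free algebra for which e_n x_(w n) = e_(n+1) and
   e_n x_i = 0 for i <> w n, where e_n is 'X^n. *)
Definition path_act w (p : {poly F}) f : {poly F} :=
  \poly_(N < size p + mmeasure (@fdeg 'I_m) f)
    \sum_(n < N.+1) p`_n * f@_(FMonom (segment w n (N - n))).

(** The truncation loses nothing: past the bound, either [n] exceeds the degree of [p] or [N - n]
    exceeds every word length in [f]. *)
Lemma coef_path_act w p f N :
  (path_act w p f)`_N = \sum_(n < N.+1) p`_n * f@_(FMonom (segment w n (N - n))).
Proof.
rewrite coef_poly; case: ltnP => // geN; rewrite big1 // => n _.
have [lt|ge] := ltnP n (size p); last by rewrite nth_default // mul0r.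
rewrite mcoeff_outdom ?mulr0 //; apply: (mmeasure_mnm_ge (mf := @fdeg 'I_m)).
by apply: leq_trans (eq_leq (esym (size_segment w n (N - n)))); lia.
Qed.

Lemma path_act1 w p : path_act w p 1 = p.
Proof.
apply/polyP => N; rewrite coef_path_act big_ord_recr /= big1 ?add0r => [|n _].
  by rewrite subnn mcoeff1 mone_word eqxx mulr1.
rewrite mcoeff1 mone_word; case: eqP => [[]|]; last by rewrite mulr0.
by move/(congr1 size); rewrite size_segment /=; have := ltn_ord n; lia.
Qed.

(** Going from [e_n] to [e_N] by [f] and then [g] passes through some [e_k]; the values of [k] match
    the splits of the segment between [n] and [N]. *)
Lemma path_actM w p f g : path_act w (path_act w p f) g = path_act w p (f * g).
Proof.
apply/polyP => N; rewrite !coef_path_act.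
under eq_bigr => k _.
  rewrite coef_path_act mulr_suml.
  rewrite (big_ord_widen_cond N.+1 xpredT (fun n => p`_n *
     f@_(FMonom (segment w n (k - n))) * g@_(FMonom (segment w k (N - k))))) //=; over.
rewrite (exchange_big_dep xpredT) //=; apply: eq_bigr => n _.
rewrite mcoeffM_segment mulr_sumr.
rewrite (eq_bigl (fun k : 'I_N.+1 => (n <= k)%N)) //.
transitivity (\sum_(n <= k < N.+1) p`_n * f@_(FMonom (segment w n (k - n))) *
     g@_(FMonom (segment w k (N - k)))).
  by rewrite (big_nat_widenl _ 0) // big_mkord.
rewrite -{1}[val n]add0n big_addn (subSn (ltnSE (ltn_ord n))) big_mkord.
by apply: eq_bigr => k _; rewrite addnK addnC subnDA mulrA.
Qed.

Lemma path_actDl w p q f : path_act w (p + q) f = path_act w p f + path_act w q f.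
Proof.
apply/polyP => N; rewrite coefD !coef_path_act -big_split; apply: eq_bigr => n _.
by rewrite coefD mulrDl.
Qed.

Lemma path_actDr w p f g : path_act w p (f + g) = path_act w p f + path_act w p g.
Proof.
apply/polyP => N; rewrite coefD !coef_path_act -big_split; apply: eq_bigr => n _.
by rewrite mcoeffD mulrDr.
Qed.

Lemma path_actZr w p c f : path_act w p (c *: f) = c *: path_act w p f.
Proof.
apply/polyP => N; rewrite coefZ !coef_path_act mulr_sumr; apply: eq_bigr => n _.
by rewrite mcoeffZ mulrCA.
Qed.

Lemma coef_path_act_Xn w c n f N : (path_act w (c *: 'X^n) f)`_N =
  if (n <= N)%N then c * f@_(FMonom (segment w n (N - n))) else 0.
Proof.
rewrite coef_path_act; case: leqP => [le|lt].
  rewrite (bigD1 (inord n)) //= big1 ?addr0 => [|k nk].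
    by rewrite inordK // coefZ coefXn eqxx mulr1.
  rewrite coefZ coefXn [_ == n](_ : _ = false) ?mulr0 ?mul0r //.
  by apply: contraNF nk => /eqP <-; rewrite inord_val.
rewrite big1 // => k _; rewrite coefZ coefXn [_ == n](_ : _ = false) ?mulr0 ?mul0r //.
by have := ltn_ord k; lia.
Qed.

End FreeAlgebra.

(** * Monomial ideals are determined by their words *)

Section MonomialIdeal.
Context (F : fieldType) (m : nat).
Implicit Types (I J : monomialIdeal F m) (f : freeAlg F m).

Lemma mideal_msupp I f : mideal I f <-> forall u, u \in msupp f -> mideal I << u >>.
Proof. by have [G ->] := mideal_words I; apply: ideal_of_words_msupp. Qed.

Lemma mideal_ext I J : (forall u, mideal I << u >> <-> mideal J << u >>) -> I = J.
Proof.
move=> h; have e : mideal I = mideal J.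
  by apply/funext => f; apply/propext; rewrite !mideal_msupp; split=> h' u /h' /h.
case: I J e {h} => [I Iw Ip] [J Jw Jp] /= e; subst J.
by congr MonomialIdeal; apply: Prop_irrelevance.
Qed.

End MonomialIdeal.

(** * Words in a monomial algebra *)

Section MonomialAlgebraTheory.
Context (F : fieldType) (m : nat) (I : monomialIdeal F m).
Local Notation A := (monomialAlgebra I).
Implicit Types (f : freeAlg F m) (u v : seq 'I_m).

Lemma mproj_eq0 f : mproj I f = 0 <-> mideal I f.
Proof. by rewrite -(raddf0 (mproj I)) mproj_eq subr0. Qed.

Lemma mproj_surj (a : A) : exists f, a = mproj I f.
Proof. by exists (repr a); rewrite mproj_repr. Qed.

Definition mword u : A := mmonom I (FMonom u).

Lemma mword_eq0 u : mword u = 0 <-> mideal I << FMonom u >>.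
Proof. exact: mproj_eq0. Qed.

Lemma mword_cat u v : mword (u ++ v) = mword u * mword v.
Proof. by rewrite /mword /mmonom -word_mul -malgU1M rmorphM. Qed.

Lemma mword_nil : mword [::] = 1.
Proof. by rewrite /mword -mone_word; exact: rmorph1. Qed.

Lemma mword_component u : mcomponent I (size u) (mword u).
Proof. by exists << FMonom u >> => //= v; rewrite msuppU1 inE => /eqP ->. Qed.

Lemma mprojU (c : F) u : mproj I << c *g FMonom u >> = c *: mword u.
Proof. by rewrite malgU_scale; exact: mproj_scalable. Qed.

Lemma mproj_sum_msupp f : mproj I f = \sum_(u <- msupp f) f@_u *: mword u.
Proof.
rewrite {1}(monalgE f) raddf_sum; apply: eq_bigr => -[u] _.
exact: mprojU.
Qed.

(** As [u] and [v] differ, [u] is in the support of [c u - d v], and a monomial ideal contains the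
    words of its elements. *)
Lemma mword_comb2_eq0 (c d : F) u v :
  c *: mword u = d *: mword v -> u <> v -> c != 0 -> mword u = 0.
Proof.
rewrite -!mprojU => /mproj_eq/mideal_msupp/(_ (FMonom u)) uI ne c0.
apply/mword_eq0/uI; rewrite -mcoeff_neq0 mcoeffB !mcoeffU eqxx.
by rewrite [_ == FMonom u](introF eqP) ?subr0 // => -[/esym].
Qed.

End MonomialAlgebraTheory.

(** * The point module of an infinite word *)

Section PathModule.
Context (F : fieldType) (m : nat) (I : monomialIdeal F m).
Local Notation A := (monomialAlgebra I).

Definition nonzero_factors (w : nat -> 'I_m) :=
  forall i k, ~ mideal I << FMonom (segment w i k) >>.

(** A copy of [{poly F}] tagged by the word, so that each word carries its own module structure. *)
Definition path_module (w : nat -> 'I_m) (_ : nonzero_factors w) : Type := {poly F}.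

Context (w : nat -> 'I_m) (wI : nonzero_factors w).
Local Notation P := (path_module wI).

HB.instance Definition _ := GRing.Zmodule.copy P {poly F}.

(** The words of [f] lie in the ideal, so none is a factor of [w]; hence the action descends to
    [A]. *)
Lemma path_act_ideal (p : {poly F}) f : mideal I f -> path_act w p f = 0.
Proof.
move=> /mideal_msupp fI; apply/polyP => N; rewrite coef_path_act coef0 big1 // => n _.
by case: msuppP => [/fI /wI //|_]; rewrite mulr0.
Qed.

Definition path_scale (a : A^c) (p : P) : P := path_act w p (repr (a : A)).

Lemma path_scale_mproj f (p : P) : path_scale (mproj I f) p = path_act w p f.
Proof.
rewrite /path_scale; set g := repr _.
rewrite -[f in RHS](subrK g) path_actDr [X in X + _]path_act_ideal ?add0r //.
by apply/mproj_eq; rewrite mproj_repr.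
Qed.

Lemma path_scaleA (a b : A^c) (p : P) :
  path_scale a (path_scale b p) = path_scale (a * b) p.
Proof.
have [f ->] := mproj_surj a; have [g ->] := mproj_surj b.
rewrite (_ : (mproj I f : A^c) * mproj I g = mproj I (g * f)); last by rewrite rmorphM.
by rewrite !path_scale_mproj path_actM.
Qed.

Lemma path_scale1 : left_id 1 path_scale.
Proof. by move=> p; rewrite (path_scale_mproj 1) path_act1. Qed.

Lemma path_scaleDr : right_distributive path_scale +%R.
Proof. by move=> a p q; apply: path_actDl. Qed.

Lemma path_scaleDl (p : P) : {morph path_scale^~ p : a b / a + b}.
Proof.
move=> a b; have [f ->] := mproj_surj a; have [g ->] := mproj_surj b.
rewrite (_ : (mproj I f : A^c) + mproj I g = mproj I (f + g)); last by rewrite raddfD.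
by rewrite !path_scale_mproj path_actDr.
Qed.

HB.instance Definition _ := GRing.Zmodule_isLmodule.Build A^c P
  path_scaleA path_scale1 path_scaleDr path_scaleDl.

Lemma ract_path (p : P) f : ract p (mproj I f) = path_act w p f.
Proof. exact: path_scale_mproj. Qed.

Lemma ract_path_scalar (p : P) (k : F) : ract p (k%:A : A) = k *: (p : {poly F}).
Proof. by rewrite -[_%:A](mproj_scalable I) ract_path path_actZr path_act1. Qed.

Definition path_gr n : set P := [set p | exists c : F, p = c *: 'X^n :> {poly F}].

Lemma path_subspace n : subspace (path_gr n).
Proof.
split=> [|_ _ [c ->] [d ->]|k _ [c ->]].
- by exists 0; rewrite scale0r.
- by exists (c + d); rewrite scalerDl.
- by exists (k * c); rewrite ract_path_scalar scalerA.
Qed.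

Lemma path_direct : direct_sum path_gr.
Proof.
split=> [p|N p pgr sum0 n ltn].
  exists (size (p : {poly F})), (fun n => (p : {poly F})`_n *: 'X^n : {poly F}).
  split=> [n|]; first by exists (p : {poly F})`_n.
  by rewrite -{1}[p : {poly F}]coefK poly_def.
have /choice[c pc] : forall n, exists c : F, p n = c *: 'X^n :> {poly F} := pgr.
have /(congr1 (fun q : {poly F} => q`_n)) : \sum_(i < N) c i *: 'X^i = 0 :> {poly F}.
  by rewrite -[RHS]sum0; apply: eq_bigr => i _; rewrite pc.
by rewrite -poly_def coef_poly ltn coef0 pc => ->; rewrite scale0r.
Qed.

(** The coefficient at [N] is that of a word of length [N - n] in [f], which vanishes unless this
    length is [k]. *)
Lemma path_graded n k (p : P) (a : A) :
  path_gr n p -> mcomponent I k a -> path_gr (n + k) (ract p a).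
Proof.
move=> [c ->] [f fk <-]; exists (c * f@_(FMonom (segment w n k))).
rewrite ract_path; apply/polyP => N; rewrite coef_path_act_Xn coefZ coefXn.
have [->|ne] := eqVneq N (n + k)%N; first by rewrite leq_addr addKn mulr1.
rewrite mulr0; case: leqP => // le.
case: msuppP => [/fk|_]; last by rewrite mulr0.
by rewrite /fdeg size_segment => e; move: ne; rewrite -e subnKC ?eqxx.
Qed.

(** The prefix of [w] of length [n] sends [e_0] to [e_n], so [p] is reached by combining prefixes
    with the coefficients of [p]. *)
Lemma path_cyclic : exists p0 : P, path_gr 0 p0 /\ forall p, exists a : A, p = ract p0 a.
Proof.
exists (1 : {poly F}); split; first by exists 1; rewrite scale1r expr0.
move=> p; pose f : freeAlg F m :=
  \sum_(n < size (p : {poly F})) << (p : {poly F})`_n *g FMonom (segment w 0 n) >>.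
exists (mproj I f); rewrite ract_path; apply/polyP => N.
rewrite -[1 in RHS]scale1r -(expr0 'X) coef_path_act_Xn mul1r subn0 raddf_sum /=.
under eq_bigr => n _.
  have e : (FMonom (segment w 0 n) == FMonom (segment w 0 N)) = (n == N :> nat).
    apply/eqP/eqP => [[/(congr1 size)]|->] //; by rewrite !size_segment.
  rewrite mcoeffU e; over.
have [lt|ge] := ltnP N (size (p : {poly F})).
  rewrite (bigD1 (Ordinal lt)) //= eqxx big1 ?addr0 // => n /eqP ne.
  by rewrite [_ == N](introF eqP) // => e; apply/ne/val_inj.
rewrite nth_default // big1 // => n _.
by rewrite [_ == N](introF eqP) // => e; move: ge; rewrite -e leqNgt ltn_ord.
Qed.

Lemma path_dim1 n : dim1 (path_gr n).
Proof.
exists ('X^n : {poly F}); split.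
- by exists 1; rewrite scale1r.
- by apply/eqP; rewrite -size_poly_eq0 size_polyXn.
- by move=> _ [c ->]; exists c; rewrite ract_path_scalar.
Qed.

Definition path_pointModule : pointModule I := PointModule path_subspace path_direct
  path_graded path_cyclic path_dim1.

(** This coefficient is read off as that of [e_(n+k)] in [e_n f]. *)
Lemma path_annihilator f n k :
  annihilator path_pointModule (mproj I f) -> f@_(FMonom (segment w n k)) = 0.
Proof.
move=> /(_ ('X^n : {poly F})); rewrite ract_path.
move/(congr1 (fun q : {poly F} => q`_(n + k))).
by rewrite -['X^n]scale1r coef_path_act_Xn leq_addr addKn mul1r coef0.
Qed.

End PathModule.

(** * Right actions and central scalars *)

Section RightAction.
Context (F : fieldType) (m : nat) (I : monomialIdeal F m).
Local Notation A := (monomialAlgebra I).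
Context (P : lmodType A^c).
Implicit Types (x y : P) (a b : A) (k l : F).

Lemma ractM x a b : ract x (a * b) = ract (ract x a) b.
Proof. by rewrite /ract scalerA. Qed.

Lemma ract1 x : ract x 1 = x.
Proof. exact: scale1r. Qed.

Lemma ract0r x : ract x 0 = 0.
Proof. exact: scale0r. Qed.

Lemma ract0l a : ract (0 : P) a = 0.
Proof. exact: scaler0. Qed.

Lemma ractBr x a b : ract x (a - b) = ract x a - ract x b.
Proof. exact: scalerBl. Qed.

Lemma ractN1 x : ract x (-1)%:A = - x.
Proof. by rewrite scaleN1r; exact: scaleN1r. Qed.

Lemma ract_suml a (J : Type) (r : seq J) (x : J -> P) :
  ract (\sum_(j <- r) x j) a = \sum_(j <- r) ract (x j) a.
Proof. exact: scaler_sumr. Qed.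

Lemma ract_sumr x (J : Type) (r : seq J) (a : J -> A) :
  ract x (\sum_(j <- r) a j) = \sum_(j <- r) ract x (a j).
Proof. exact: scaler_suml. Qed.

Lemma ractZ x k a : ract x (k *: a) = ract (ract x a) k%:A.
Proof. by rewrite -ractM -scalerAr mulr1. Qed.

Lemma ract_scalarC x k a : ract (ract x k%:A) a = ract (ract x a) k%:A.
Proof. by rewrite -ractZ -ractM -scalerAl mul1r. Qed.

(** Scalars being central, both terms send [x] to [y] times [k l]. *)
Lemma ract_comb2_eq0 x y k l a b : ract x a = ract y k%:A ->
  ract x b = ract y l%:A -> ract x (l *: a - k *: b) = 0.
Proof.
move=> xa xb.
have -> : ract x (l *: a - k *: b) = ract (ract x a) l%:A - ract (ract x b) k%:A :=
  etrans (ractBr _ _ _) (f_equal2 (fun y z => y - z) (ractZ x l a) (ractZ x k b)).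
rewrite xa xb.
exact (etrans (f_equal (fun z => z - _) (ract_scalarC _ _ _)) (subrr _)).
Qed.

Lemma ract_scalar_eq0 x k : ract x k%:A = 0 -> k <> 0 -> x = 0.
Proof.
move=> x0 /eqP k0; have e : k%:A * k^-1%:A = 1 :> A.
  by rewrite -scalerAl mul1r scalerA mulfV // scale1r.
by rewrite -[x]ract1 -e ractM x0 ract0l.
Qed.

End RightAction.

(** * Bases and supports of point modules *)

Section PointModuleTheory.
Context (F : fieldType) (m : nat) (I : monomialIdeal F m) (P : pointModule I).
Local Notation A := (monomialAlgebra I).
Implicit Types (x y : P) (a b : A) (k : F) (u v : seq 'I_m).

Definition point_gen n : P := projT1 (cid (pm_dim1 P n)).
Local Notation e := point_gen.

Lemma point_gen_gr n : pm_gr n (e n).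
Proof. by case: (projT2 (cid (pm_dim1 P n))). Qed.

Lemma point_gen_neq0 n : e n <> 0.
Proof. by case: (projT2 (cid (pm_dim1 P n))). Qed.

Lemma point_gr_span n x : pm_gr n x -> exists k : F, x = ract (e n) k%:A.
Proof. by case: (projT2 (cid (pm_dim1 P n))) => _ _; apply. Qed.

Lemma ract_mword_gr n x u : pm_gr n x -> pm_gr (n + size u) (ract x (mword I u)).
Proof. by move=> /pm_graded; apply; apply: mword_component. Qed.

Lemma ract_gen_mword n u :
  exists k : F, ract (e n) (mword I u) = ract (e (n + size u)) k%:A.
Proof. exact/point_gr_span/ract_mword_gr/point_gen_gr. Qed.

(** The [e_n] span the module over [F], and scalars commute with the action. *)
Lemma point_annihilatorP a : (forall n, ract (e n) a = 0) -> annihilator P a.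
Proof.
move=> ea x; have [/(_ x)[N [p [pgr ->]]] _] := pm_direct P.
rewrite ract_suml big1 // => n _; have [k ->] := point_gr_span (pgr n).
by rewrite ract_scalarC ea ract0l.
Qed.

Lemma faithful_eq0 a : faithful P -> annihilator P a -> a = 0.
Proof. by move=> ->. Qed.

Definition point_support n (i : 'I_m) := ract (e n) (mword I [:: i]) <> 0.

(** A letter sends [e_n] to a multiple of [e_(n+1)], nonzero exactly when the letter is in the
    support; induct along [u]. *)
Lemma point_occurs n u : occurs point_support n u <-> ract (e n) (mword I u) <> 0.
Proof.
elim: u n => [|i u IH] n /=.
  by rewrite mword_nil ract1; split=> // _; apply: point_gen_neq0.
rewrite -cat1s mword_cat ractM /point_support IH.
have [k ->] := ract_gen_mword n [:: i]; rewrite addn1 ract_scalarC.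
have [->|/eqP k0] := eqVneq k 0; first by rewrite scale0r !ract0r; tauto.
split=> [[_ eu /ract_scalar_eq0/(_ k0)]|h] //.
split=> [/ract_scalar_eq0/(_ k0)/point_gen_neq0 //|eu].
by apply: h; rewrite eu ract0l.
Qed.

(* The degree n + 1 part of P is obtained from the generator by words of length
   n + 1; split off the last letter of one that does not kill it. *)
Lemma point_support_nonempty n : exists i, point_support n i.
Proof.
have [x0 [x0gr gen]] := pm_cyclic P.
have [u szu x0u] : exists2 u, size u = n.+1 & ract x0 (mword I u) <> 0.
  apply: contrapT => no; have [a ea] := gen (e n.+1); have [f af] := mproj_surj a.
  (* The component of [x0 f] in degree [j]. *)
  pose q j := \sum_(u <- msupp f | fdeg u == j) ract (ract x0 (mword I u)) (f@_u)%:A.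
  have qgr j : pm_gr j (q j).
    have [g0 gD gZ] := @pm_subspace _ _ _ P j.
    apply: big_ind => // -[u] /eqP ej; apply: gZ; rewrite -ej.
    exact: ract_mword_gr x0gr.
  have q0 : q n.+1 = 0.
    rewrite /q big1 // => -[u] /eqP szu.
    rewrite [ract x0 _](contrapT (P := _ = 0)) ?ract0l // => x0u.
    by apply: no; exists u.
  (* Large enough to exceed [n.+1] and every word length in [f]. *)
  pose N := (n.+2 + mmeasure (@fdeg 'I_m) f)%N.
  have sumq : \sum_(j < N) q j = e n.+1.
    rewrite ea af mproj_sum_msupp ract_sumr (exchange_big_dep xpredT) //=.
    rewrite big_seq [RHS]big_seq; apply: eq_bigr => u uf.
    have ltu : (fdeg u < N)%N by apply: ltn_addl; exact: mmeasure_mnm_lt uf.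
    rewrite ractZ (eq_bigl (pred1 (Ordinal ltu))); first by rewrite big_pred1_eq.
    by move=> j; rewrite /= eq_sym -val_eqE.
  (* These are the components of [x0 f - e_(n+1) = 0]; directness kills the one in degree [n.+1],
     which is [- e_(n+1)]. *)
  pose p j := q j - (if j == n.+1 then e n.+1 else 0).
  have pgr j : pm_gr j (p j).
    have [g0 gD gZ] := @pm_subspace _ _ _ P j.
    apply: gD => //; case: eqP => [<-|_]; last by rewrite oppr0.
    by rewrite -ractN1; apply/gZ/point_gen_gr.
  have ltn1N : (n.+1 < N)%N by apply: leq_addr.
  have [_ /(_ N p pgr)/(_ _ n.+1 ltn1N)] := pm_direct P.
  rewrite /p eqxx q0 sub0r => h; apply: (@point_gen_neq0 n.+1); apply/eqP.
  rewrite -oppr_eq0; apply/eqP/h; rewrite sumrB sumq -big_mkcond.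
  by rewrite (big_pred1 (Ordinal ltn1N)) ?subrr // => j; rewrite /= -val_eqE.
case/lastP: u szu x0u => // u i; rewrite size_rcons => -[szu].
rewrite -cats1 mword_cat ractM.
have [k ->] : exists k : F, ract x0 (mword I u) = ract (e n) k%:A.
  by apply: point_gr_span; rewrite -szu -[size u]add0n; apply: ract_mword_gr.
by rewrite ract_scalarC => h; exists i => ei; apply: h; rewrite ei ract0l.
Qed.

(* Since P_(size u) is a line, a nontrivial combination of u and v kills P_0,
   hence all of P. *)
Lemma faithful_occurs_inj u v : faithful P -> size u = size v ->
  occurs point_support 0 u -> occurs point_support 0 v ->
  (forall n, (0 < n)%N -> ~ occurs point_support n u) ->
  (forall n, (0 < n)%N -> ~ occurs point_support n v) -> u = v.
Proof.
move=> Pf szuv /point_occurs u0 /point_occurs v0 un vn; apply: contrapT => ne.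
have [c uc] := ract_gen_mword 0 u; have [d vd] := ract_gen_mword 0 v.
have d0 : d != 0.
  by apply/eqP => d0; apply: v0; rewrite vd d0 scale0r ract0r.
apply: u0; have -> : mword I u = 0; last exact: ract0r.
(* It remains to see that [d u - c v] annihilates each [e_n], in degree 0 by the choice of [c] and
   [d]. *)
apply: (mword_comb2_eq0 (d := c) (subr0_eq _) ne d0).
apply: faithful_eq0 Pf _; apply: point_annihilatorP => -[|n].
  exact: ract_comb2_eq0 uc (etrans vd (congr1 (fun s => ract (e s) d%:A) (esym szuv))).
(* In positive degrees both words act as zero, so the common target is taken to be 0. *)
by apply: (@ract_comb2_eq0 _ _ _ _ _ 0); rewrite ract0l; apply: contrapT => /point_occurs;
  [apply: un|apply: vn].
Qed.

End PointModuleTheory.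

(** * Faithfulness and prolongability in terms of infinite words *)

Section PointModules.
Context (F : fieldType) (m : nat) (I : monomialIdeal F m).
Implicit Types (f : freeAlg F m) (u v : seq 'I_m) (w : nat -> 'I_m).

Lemma annihilator0 (P : pointModule I) : annihilator P 0.
Proof. by move=> x; apply: ract0r. Qed.

Lemma word_ideal_nonzero_factors w : I = word_ideal F w -> nonzero_factors I w.
Proof.
by move=> -> i k /word_idealP; apply; exists i; rewrite size_segment.
Qed.

(** A word of [f] outside the ideal is a factor of [w] at some [i], and [e_i] detects its
    coefficient. *)
Lemma word_ideal_path_faithful w (Iw : I = word_ideal F w) :
  faithful (path_pointModule (word_ideal_nonzero_factors Iw)).
Proof.
apply/funext => a; apply/propext; split=> [|->]; last exact: annihilator0.
have [f ->] := mproj_surj a => fa; apply/mproj_eq0/mideal_msupp => -[u] uf.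
rewrite Iw word_idealP => -[i ui]; move: uf.
by rewrite ui -mcoeff_neq0 (path_annihilator i _ fa) eqxx.
Qed.

(** By faithfulness a word is zero in [A] exactly when it kills every [e_n], that is, when it occurs
    nowhere in the supports. *)
Lemma faithful_word_ideal (P : pointModule I) :
  faithful P -> exists w, I = word_ideal F w.
Proof.
move=> Pf; have [|u v|w wP] := @occurs_factor_word _ (@point_support _ _ _ P).
- exact: point_support_nonempty.
- exact: faithful_occurs_inj.
exists w; apply: mideal_ext => -[u]; rewrite word_idealP -wP -mword_eq0.
split=> [u0 [n /point_occurs]|nu]; first by rewrite u0 ract0r.
apply: (faithful_eq0 Pf); apply: point_annihilatorP => n.
by apply: contrapT => un; apply: nu; exists n; apply/point_occurs.
Qed.

(** Prolonging [u] forever gives [w] with arbitrarily long nonzero prefixes, and every factor lies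
    inside one of them. *)
Lemma prolongable_word u : prolongable I -> mword I u <> 0 ->
  exists w, nonzero_factors I w /\ segment w 0 (size u) = u.
Proof.
move=> Iprol u0.
have [//|j p p0|w [wu wP]] :=
    @prolongation_limit _ (fun p => mword I p <> 0) (fun _ _ => True) u.
  have [[v] [vn pv]] := Iprol (FMonom p) p0.
  by exists v; split; [exact: vn|rewrite mword_cat|].
exists w; split=> // i k ik0.
have [l [leil wl _]] := wP (i + k)%N; apply: wl.
rewrite -(subnKC leil) !segmentD add0n !mword_cat.
by rewrite [X in _ * X * _](_ : _ = 0) ?mulr0 ?mul0r //; apply/mword_eq0.
Qed.

(** A nonzero word of [f] starts some admissible [w], and [e_0] in the module of [w] detects its
    coefficient. *)
Lemma prolongable_point_annihilator : prolongable I -> point_annihilator I = [set 0].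
Proof.
move=> Iprol; apply/funext => a; apply/propext; split=> [|-> P]; last exact: annihilator0.
have [f ->] := mproj_surj a => fa; apply/mproj_eq0/mideal_msupp => -[u] uf.
rewrite -mword_eq0; apply: contrapT => u0.
have [w [wI wu]] := prolongable_word Iprol u0; move: uf.
by rewrite -wu -mcoeff_neq0 (path_annihilator 0 _ (fa (path_pointModule wI))) eqxx.
Qed.

(** Some [e_n] in some point module survives [u]; a letter in the support at [n + size u] then
    prolongs [u]. *)
Lemma point_annihilator_prolongable : point_annihilator I = [set 0] -> prolongable I.
Proof.
move=> I0 [u] u0.
have /existsNP[P Pu] : ~ point_annihilator I (mword I u) by rewrite I0.
have [n un] : exists n, ract (point_gen P n) (mword I u) <> 0.
  apply: contrapT => no; apply/Pu/point_annihilatorP => n.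
  by apply: contrapT => un; apply: no; exists n.
have [i Si] := point_support_nonempty P (n + size u).
exists (FMonom [:: i]); split=> // ui.
have /point_occurs : occurs (@point_support _ _ _ P) n (u ++ [:: i]).
  by rewrite occurs_cat point_occurs /=.
by rewrite mword_cat ui; apply; apply: ract0r.
Qed.

End PointModules.

Theorem theorem1p1 (F : fieldType) (m : nat) (I : monomialIdeal F m) :
  ((exists w : nat -> 'I_m, I = word_ideal F w) <->
   (exists P : pointModule I, faithful P)) /\
  (prolongable I <-> point_annihilator I = [set 0]).
Proof.
split; split.
- case=> w Iw; exists (path_pointModule (word_ideal_nonzero_factors Iw)).
  exact: word_ideal_path_faithful.
- by case=> P /faithful_word_ideal.
- exact: prolongable_point_annihilator.
- exact: point_annihilator_prolongable.
Qed.
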